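(* Let $G$ be a nonempty $2K_2$-free graph. Then every vertex of $G$ of maximum degree (that is, every $x\in V(G)$ with $d_G(x)=\Delta(G)$) belongs to every longest path in $G$.
   Context: All graphs are finite and simple; $G$ is not assumed to be connected. A graph is nonempty if it contains at least one edge. A graph is $2K_2$-free if it does not contain two independent edges as an induced subgraph, i.e. it has no induced subgraph isomorphic to the disjoint union of two copies of $K_2$. A path $P$ in $G$ is a longest path in $G$ if there is no path in $G$ strictly longer than $P$. $\Delta(G)$ denotes the maximum degree of $G$. *)

(* Defs.v *)
From mathcomp Require Import all_boot.

Set Implicit Arguments.
Unset Strict Implicit.
Unset Printing Implicit Defensive.

(* A finite simple graph is given by its adjacency relation on a finType. *)
Definition simple_graph (V : finType) (e : rel V) : Prop :=
  symmetric e /\ irreflexive e.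

Definition nonempty_graph (V : finType) (e : rel V) : Prop :=
  exists x, exists y, e x y.

Definition deg (V : finType) (e : rel V) (x : V) : nat := #|[set y | e x y]|.

Definition max_deg (V : finType) (e : rel V) : nat := \max_(x : V) deg e x.

Definition complete_graph (n : nat) : rel 'I_n := fun i j => i != j.

Definition disjoint_union (U W : finType) (e : rel U) (f : rel W) :
    rel (U + W)%type :=
  fun a b => match a, b with
             | inl x, inl y => e x y
             | inr x, inr y => f x y
             | _, _ => false
             end.

(* phi is an isomorphism from (U, h) onto the subgraph of (V, e) induced by the
   image of phi. *)
Definition has_induced (U V : finType) (h : rel U) (e : rel V) : Prop :=
  exists phi : U -> V, injective phi /\ forall a b, e (phi a) (phi b) = h a b.

Definition two_K2 : rel ('I_2 + 'I_2)%type :=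
  disjoint_union (@complete_graph 2) (@complete_graph 2).

Definition two_K2_free (V : finType) (e : rel V) : Prop :=
  ~ has_induced two_K2 e.

(* A path is the nonempty sequence of its distinct vertices. Its length, the
   number of edges, is (size p).-1, so comparing sizes compares lengths. *)
Definition graph_path (V : finType) (e : rel V) (p : seq V) : Prop :=
  [/\ p <> [::], uniq p & sorted e p].

Definition longest_path (V : finType) (e : rel V) (p : seq V) : Prop :=
  graph_path e p /\ forall q : seq V, graph_path e q -> ~ size p < size q.

(* Main.v *)
Require Import Defs.
From mathcomp Require Import all_boot.

(** Let p be a longest path avoiding a vertex x of maximum degree d > 0; the
    contradiction is a vertex of degree at least d + 1.

    In a 2K_2-free graph the vertices off p only have neighbours on p
    ([longest_dominates]).  Call S the set of vertices of p in front of which x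
    can be placed: the head of p and the successors of the neighbours of x.  By
    the usual rerouting arguments, x |: S is an independent set, for otherwise
    x could be added to the path ([insertion_set_nonadjacent],
    [insertion_set_independent]).  The last vertex of p is not a neighbour of
    x, so every neighbour of x has a successor and S has at least d + 1
    elements ([deg_lt_insertion_set]).

    Let I = x |: S, let y be a vertex with the most neighbours in I, let A be
    the set of these neighbours, B = I \ A and N(B) the neighbourhood of B.
    Being 2K_2-free forces N(B) into the neighbourhood of y, so
    deg y >= |A| + |N(B)| with A nonempty ([exists_deg_ge]).  If x is in B, then
    N(B) contains the d neighbours of x and deg y >= 1 + d.  Otherwise B lies on
    p, and mapping a vertex of p to its predecessor gives |N(B)| >= |B| - 1
    ([card_le_neighbours]), so that deg y >= |I| - 1 >= d + 1. *)

Set Implicit Arguments.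
Unset Strict Implicit.

(** * Independent sets in 2K_2-free graphs *)

(** The four vertices need not be assumed distinct: if two of them from
    different edges coincide, one of the two edges is itself the chord. *)
Lemma two_K2_freeE (V : finType) (e : rel V) (a b c d : V) :
  simple_graph e -> two_K2_free e -> e a b -> e c d ->
  [|| e a c, e a d, e b c | e b d].
Proof.
move=> [sym irr] free ab cd; apply/negPn/negP.
rewrite !negb_or => /and4P[/negbTE ac /negbTE ad /negbTE bc /negbTE bd].
have neq_ab : a <> b by move=> E; rewrite E irr in ab.
have neq_cd : c <> d by move=> E; rewrite E irr in cd.
have neq_ac : a <> c by move=> E; rewrite E cd in ad.
have neq_ad : a <> d by move=> E; rewrite E sym cd in ac.
have neq_bc : b <> c by move=> E; rewrite E cd in bd.
have neq_bd : b <> d by move=> E; rewrite E sym cd in bc.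
apply: free.
exists (fun u : 'I_2 + 'I_2 => match u with
  | inl i => if i == ord0 then a else b
  | inr i => if i == ord0 then c else d end).
have ord2 : forall i : 'I_2, (i = ord0) \/ (i = ord_max).
  by case=> [[|[|//]] lt_i]; [left|right]; apply: val_inj.
split.
- by move=> [i|i] [j|j]; case: (ord2 i) (ord2 j) => -> [] -> //= E;
    case: (nesym neq_ab, nesym neq_cd, nesym neq_ac, nesym neq_ad,
           nesym neq_bc, nesym neq_bd) => [[[[[]]]]].
by move=> [i|i] [j|j]; case: (ord2 i) (ord2 j) => -> [] -> //=;
   rewrite ?irr ?ab ?cd ?ac ?ad ?bc ?bd // sym ?ab ?cd ?ac ?ad ?bc ?bd.
Qed.

(** A vertex y that sees as many elements of I as possible is adjacent to every
    neighbour of an element of I that y misses.  Since I is independent, these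
    neighbours are distinct from the elements of I that y sees, and the two
    contributions to the degree of y add up. *)
Lemma exists_deg_ge (V : finType) (e : rel V) (I : {set V}) (s v : V) :
  simple_graph e -> two_K2_free e -> {in I &, forall t u, ~~ e t u} ->
  s \in I -> e s v ->
  exists y, let A := [set t in I | e y t] in
    0 < #|A| /\ #|A| + #|\bigcup_(t in I :\: A) [set z | e t z]| <= deg e y.
Proof.
move=> simple free indep sI sv; have [sym irr] := simple.
pose f y := #|[set t in I | e y t]|.
have [y _ /(_ _ isT) max_y] := @arg_maxnP V v predT f isT.
exists y; split; first apply: leq_trans (max_y v).
  by apply/card_gt0P; exists s; rewrite inE sI sym.
set A := [set t in I | e y t]; set NB := \bigcup_(_ in _) _.
have disj : [disjoint A & NB].
  apply/pred0P => u /=; apply/negP => /andP[].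
  rewrite inE => /andP[uI _] /bigcupP[t]; rewrite !inE => /andP[_ tI] tu.
  by rewrite (negPf (indep _ _ tI uI)) in tu.
rewrite -cardsUI (disjoint_setI0 disj) cards0 addn0 subset_leq_card //.
apply/subsetP => z; rewrite !inE => /orP[/andP[] //|/bigcupP[t]].
rewrite !inE => /andP[+ tI] tz; rewrite tI /= => yt.
(* z sees t, which y misses; as z sees no more of I than y, it misses some u
   that y sees, and the edges tz and uy need a chord. *)
have /subsetPn[u] : ~~ (A \subset [set t in I | e z t]).
  apply/negP => sub; have := max_y z; apply/negP; rewrite -ltnNge.
  apply/proper_card/properP; split=> //; exists t; rewrite !inE tI //=.
  by rewrite sym.
rewrite !inE => /andP[uI yu]; rewrite uI /= => zu.
have := two_K2_freeE simple free tz yu.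
rewrite (sym t y) (negPf yt) (negPf (indep _ _ tI uI)) (negPf zu) orbF /=.
by rewrite sym.
Qed.

(** * Rerouting a longest path *)

(** The condition on the prefix says that s is the head of p or that its
    predecessor is adjacent to x; phrasing it with the prefix treats both cases
    alike. *)
Definition insertion_set (V : finType) (e : rel V) (p : seq V) (x : V) :=
  [set s in p | sorted e (rcons (take (index s p) p) x)].

Lemma mem_insertion_set (V : finType) (e : rel V) (a b : seq V) (x s : V) :
  uniq (a ++ s :: b) ->
  (s \in insertion_set e (a ++ s :: b) x) = sorted e (rcons a x).
Proof.
rewrite cat_uniq /= negb_or => /and3P[_ /andP[s_a _] _].
rewrite inE mem_cat mem_head orbT index_cat (negPf s_a) /= eqxx addn0.
by rewrite take_size_cat.
Qed.

Lemma longest_no_extension (V : finType) (e : rel V) (p q : seq V) (x : V) :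
  longest_path e p -> x \notin p -> sorted e q -> perm_eq q (x :: p) -> False.
Proof.
move=> [[_ uniq_p _] longest] xNp sorted_q eq_q.
have size_q := perm_size eq_q.
apply: (longest q); last by rewrite size_q.
split=> //; first by move=> q0; rewrite q0 in size_q.
by rewrite (perm_uniq eq_q) /= xNp.
Qed.

Lemma longest_no_insertion (V : finType) (e : rel V) (a b : seq V) (x s : V) :
  longest_path e (a ++ s :: b) -> x \notin a ++ s :: b ->
  sorted e (rcons a x) -> ~~ e x s.
Proof.
move=> longest xNp ax; apply/negP => xs; have [[_ _ sorted_p] _] := longest.
apply: (longest_no_extension (q := a ++ x :: s :: b) longest xNp).
  move: sorted_p; rewrite !sorted_cat_cons ax /= xs => /andP[_ ->] //.
by rewrite -[x :: s :: b]cat1s perm_catCA.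
Qed.

(** Otherwise a, x, c backwards, s, t, b is a longer path: x leads to the last
    vertex of s :: c, the segment is traversed in reverse, and the edge st
    rejoins the rest of the path. *)
Lemma longest_no_reversal (V : finType) (e : rel V) (a c b : seq V) (x s t : V) :
  symmetric e ->
  longest_path e (a ++ s :: c ++ t :: b) -> x \notin a ++ s :: c ++ t :: b ->
  sorted e (rcons a x) -> path e s (rcons c x) -> ~~ e s t.
Proof.
move=> sym longest xNp ax cx; apply/negP => st.
have [[_ _ sorted_p] _] := longest.
apply: (longest_no_extension (q := a ++ x :: rev (s :: c) ++ t :: b) longest xNp).
  have xc : path e x (rev (s :: c)).
    rewrite -[path _ _ _]/(sorted e (x :: rev (s :: c))) -rev_rcons rev_sorted.
    by rewrite (eq_sorted (e' := e)) // => u w; rewrite sym.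
  rewrite sorted_cat_cons ax cat_path xc rev_cons last_rcons /= st.
  move: sorted_p; rewrite -cat_cons catA sorted_cat_cons => /andP[_ ->] //.
rewrite -[x :: _]cat1s perm_catCA /= perm_cons perm_cat2l -cat_cons perm_cat2r.
by rewrite perm_rev.
Qed.

Lemma mem_split (T : eqType) (p : seq T) (s : T) :
  s \in p -> exists a b, p = a ++ s :: b.
Proof. by case/path.splitPr=> a b; exists a, b. Qed.

Lemma next_cat (T : eqType) (a b : seq T) (v w : T) :
  uniq (a ++ v :: w :: b) -> next (a ++ v :: w :: b) v = w.
Proof.
by move=> uniq_p; rewrite -(next_rot (size a)) // rot_size_cat /= eqxx.
Qed.

(** The function [prev] is cyclic, so only the head has a predecessor that may
    fail to be adjacent. *)
Lemma prev_adjacent (V : finType) (e : rel V) (h : V) (p : seq V) (s : V) :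
  path e h p -> s \in h :: p -> s != h -> e (prev (h :: p) s) s.
Proof.
move=> path_p s_p s_h.
(* Adding the arcs into h closes the path into a cycle without affecting the
   arcs into s. *)
pose e' := [rel u w | e u w || (w == h)].
have cycle_p : cycle e' (h :: p).
  rewrite /= rcons_path /= eqxx orbT andbT.
  by apply: sub_path path_p => u w /= ->.
by have := prev_cycle cycle_p s_p; rewrite /= (negPf s_h) orbF.
Qed.

(** * The vertices in front of which a missed vertex fits *)

Section InsertionSet.

Variables (V : finType) (e : rel V) (h : V) (p' : seq V) (x : V).
Let p := h :: p'.
Hypothesis simple : simple_graph e.
Hypotheses (longest : longest_path e p) (xNp : x \notin p).
Let S := insertion_set e p x.

Let uniq_p : uniq p. Proof. by case: longest => [[]]. Qed.

Lemma head_insertion_set : h \in S.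
Proof. by rewrite (@mem_insertion_set _ e [::]). Qed.

Lemma insertion_set_sub s : s \in S -> s \in p.
Proof. by rewrite inE => /andP[]. Qed.

Lemma insertion_set_nonadjacent s : s \in S -> ~~ e x s.
Proof.
move=> sS; have [a [b Ep]] := mem_split (insertion_set_sub sS).
move: sS longest xNp uniq_p; rewrite /S Ep => + long xNab uniq_ab.
by rewrite mem_insertion_set //; apply: longest_no_insertion long xNab.
Qed.

(** For s before t in S, the vertex just before t is adjacent to x, so that the
    segment from s to there can be reversed behind x. *)
Lemma insertion_set_independent : {in S &, forall s t, ~~ e s t}.
Proof.
have [sym irr] := simple.
suff ordered s t : s \in S -> t \in S -> index s p < index t p -> ~~ e s t.
  move=> s t sS tS; case: (ltngtP (index s p) (index t p)); first exact: ordered.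
    by rewrite sym; apply: ordered.
  by move/(index_inj h (insertion_set_sub sS)) => ->; rewrite ?irr ?insertion_set_sub.
move=> sS tS lt_st.
have [a [d Ep]] := mem_split (insertion_set_sub sS).
have t_d : t \in d.
  have := insertion_set_sub tS; rewrite Ep mem_cat inE.
  case/or3P => // [t_a|/eqP ts]; last by rewrite ts ltnn in lt_st.
  have s_a : s \notin a.
    by move: uniq_p; rewrite Ep cat_uniq /= negb_or => /and3P[_ /andP[]].
  move: lt_st; rewrite Ep !index_cat t_a (negPf s_a) /= eqxx addn0.
  by rewrite ltnNge ltnW // index_mem.
have [c [b Ed]] := mem_split t_d; rewrite Ed in Ep.
move: sS tS longest xNp uniq_p; rewrite /S Ep => + + long xNq uniq_q.
rewrite mem_insertion_set // => ax.
rewrite -cat_cons catA mem_insertion_set -?catA //.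
rewrite rcons_cat rcons_cons sorted_cat_cons => /andP[_ cx].
exact: longest_no_reversal long xNq ax cx.
Qed.

Hypothesis nbrs_on_p : forall v, e x v -> v \in p.

Lemma next_insertion_set v : e x v -> next p v \in S :\ h.
Proof.
have [sym irr] := simple.
move=> xv; have [a [[|w b] Ep]] := mem_split (nbrs_on_p xv).
  (* If v were the last vertex, x could be appended to p. *)
  exfalso; have [[_ _ sorted_p] _] := longest.
  apply: (longest_no_extension (q := rcons p x) longest xNp).
    rewrite Ep -cats1 -catA sorted_cat_cons /= sym xv andbT.
    by move: sorted_p; rewrite Ep sorted_cat_cons => /andP[->].
  by rewrite perm_rcons.
have [[_ _ sorted_p] _] := longest.
have uniq_ab := uniq_p; rewrite Ep in uniq_ab.
have -> : next p v = w by rewrite Ep next_cat.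
apply/setD1P; split.
  apply/eqP => wh; move: uniq_ab Ep; rewrite /p -wh.
  case: a => [|z a] /= + [Ez _]; rewrite -Ez ?inE ?eqxx //.
  by rewrite mem_cat !inE eqxx !orbT.
move: sorted_p; rewrite /S Ep -cat_rcons in uniq_ab *.
rewrite mem_insertion_set //.
rewrite cat_rcons sorted_cat_cons => /andP[av _].
by rewrite -cats1 cat_rcons sorted_cat_cons av /= sym xv.
Qed.

Lemma deg_lt_insertion_set : deg e x < #|S|.
Proof.
rewrite (cardsD1 h) head_insertion_set ltnS.
rewrite /deg -(card_imset _ (can_inj (prev_next uniq_p))) subset_leq_card //.
by apply/subsetP => _ /imsetP[v + ->]; rewrite inE; apply: next_insertion_set.
Qed.

(** Predecessors on p are neighbours and are pairwise distinct; the only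
    vertex for which this gives nothing is the head. *)
Lemma card_le_neighbours (B : {set V}) :
  {subset B <= p} -> #|B| <= (#|\bigcup_(t in B) [set z | e t z]|).+1.
Proof.
have [sym irr] := simple; move=> subBp.
rewrite (cardsD1 h) -add1n leq_add ?leq_b1 //.
rewrite -(card_imset _ (can_inj (next_prev uniq_p))) subset_leq_card //.
apply/subsetP => _ /imsetP[s /setD1P[s_h sB] ->].
apply/bigcupP; exists s => //; rewrite inE sym.
by have [[_ _ path_p] _] := longest; apply: prev_adjacent (subBp s sB) s_h.
Qed.

End InsertionSet.

(** * Longest paths meet every vertex of maximum degree *)

(** Let s, t be the first two vertices of p.  If the edge xv were off p, it
    would have a chord to the edge st.  A chord at s lets x or v be prepended,
    and a chord at t allows s to be replaced by the two vertices x and v. *)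
Lemma longest_dominates (V : finType) (e : rel V) (p : seq V) (x v : V) :
  simple_graph e -> two_K2_free e -> longest_path e p -> 1 < size p ->
  x \notin p -> e x v -> v \in p.
Proof.
case: p => [|s [|t p]] // simple free long _ xNp xv; apply/negPn/negP => vNp.
have [sym irr] := simple; have [[_ uniq_p /andP[st tp]] longest] := long.
have xs : ~~ e x s by apply: (@longest_no_insertion _ e [::]) long xNp _.
have vs : ~~ e v s by apply: (@longest_no_insertion _ e [::]) long vNp _.
have detour u w : u \notin [:: s, t & p] -> w \notin [:: s, t & p] ->
    e u w -> ~~ e t w.
  move=> uNp wNp uw; apply/negP => tw.
  apply: (longest [:: u, w, t & p]) => //; split=> //=.
    move: uNp wNp uniq_p; rewrite /= !inE !negb_or.
    move=> /and3P[_ -> ->] /and3P[_ -> ->] /and3P[_ -> ->]; rewrite !andbT.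
    by apply/eqP => E; rewrite E irr in uw.
  by rewrite uw sym tw.
have := two_K2_freeE simple free st xv.
rewrite (sym s x) (negPf xs) (sym s v) (negPf vs) /=.
by rewrite (negPf (detour v x _ _ _)) ?(negPf (detour x v _ _ _)) // sym.
Qed.

Theorem theorem1p1 (V : finType) (e : rel V) (He : simple_graph e)
    (Hne : nonempty_graph e) (Hfree : two_K2_free e) :
  forall x : V, deg e x = max_deg e ->
  forall p : seq V, longest_path e p -> x \in p.
Proof.
move=> x max_x p longest; apply/negPn/negP => xNp.
have [sym irr] := He; have [u [w uw]] := Hne.
have deg_le y : deg e y <= deg e x by rewrite max_x; apply: leq_bigmax.
have size_p : 1 < size p.
  have [_ max_p] := longest; rewrite ltnNge; apply/negP => p1.
  apply: (max_p [:: u; w]) => //; split; rewrite //= ?uw //.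
  by rewrite inE andbT; apply/eqP => E; rewrite E irr in uw.
have [v xv] : exists v, e x v.
  have /card_gt0P[v] : 0 < deg e x.
    by apply: leq_trans (deg_le u); apply/card_gt0P; exists w; rewrite inE.
  by rewrite inE; exists v.
have nbrs_on_p z : e x z -> z \in p.
  exact: longest_dominates He Hfree longest size_p xNp.
case: p longest xNp nbrs_on_p size_p => [|h p] longest xNp nbrs_on_p // _.
pose S := insertion_set e (h :: p) x.
have card_S : deg e x < #|S| by apply: deg_lt_insertion_set.
have xNS : x \notin S by apply: contra xNp; apply: insertion_set_sub.
have xS s : s \in S -> ~~ e x s by apply: insertion_set_nonadjacent.
have indep : {in x |: S &, forall s t, ~~ e s t}.
  move=> s t /setU1P[->|sS] /setU1P[->|tS]; rewrite ?irr ?xS //.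
    by rewrite sym xS.
  exact: insertion_set_independent He longest xNp _ _ sS tS.
have [y] := exists_deg_ge He Hfree indep (setU11 x S) xv.
set A := [set t in _ | _] => -[A_gt0 A_NB]; set NB := \bigcup_(_ in _) _ in A_NB.
have := deg_le y; apply/negP; rewrite -ltnNge; apply: leq_trans A_NB.
(* If y misses x, it is adjacent to all d neighbours of x and to an element of
   A; if y sees x, the part of I that y misses lies on p. *)
have [xA|xNA] := boolP (x \in A); last first.
  apply: (@leq_add 1) => //; apply/subset_leq_card/subsetP => z; rewrite inE.
  move=> xz; apply/bigcupP; exists x; last by rewrite inE.
  by rewrite in_setD xNA setU11.
have AsubI : A \subset x |: S by apply/subsetP => s; rewrite inE => /andP[].
have cardI : #|A| + #|(x |: S) :\: A| = #|S|.+1.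
  by have := cardsID A (x |: S); rewrite (setIidPr AsubI) cardsU1 xNS.
have B_NB : #|(x |: S) :\: A| <= #|NB|.+1.
  apply: (card_le_neighbours He longest) => s /setDP[/setU1P[->|]]; first by rewrite xA.
  by move/insertion_set_sub.
by apply: leq_trans card_S _; rewrite -ltnS -cardI -addnS leq_add2l.
Qed.
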